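(* Let $G$ be an abelian group with identity $e$, $R$ a $G$-graded $gr$-Noetherian ring, $M$ a graded $R$-module, $N=\oplus_{h\in G}N_h$ a graded submodule of $M$ and $g\in G$. If $M_g$ is a fully $g$-idempotent $R_e$-module and $(N_g:_{R_e}M_g)$ is an $e$-$2$-absorbing primary ideal of $R_e$, then $N_g$ is a $g$-$G2$-absorbing submodule of the $R_e$-module $M_g$.
   Context: All rings are commutative with identity and all modules are unitary. $G$ is an abelian multiplicative group with identity $e$. A $G$-graded ring is $R=\oplus_{g\in G}R_g$ with $R_gR_h\subseteq R_{gh}$; $R_e$ is a subring containing $1$. $R$ is $gr$-Noetherian if it satisfies the ascending chain condition on graded ideals. A graded $R$-module is $M=\oplus_{g\in G}M_g$ with $R_gM_h\subseteq M_{gh}$; each $M_g$ is an $R_e$-module. A submodule $N$ of $M$ is graded if $N=\oplus_g N_g$ with $N_g=N\cap M_g$. For an $R_e$-submodule $L$ of $M_g$ and $X$ an element or subset of $M_g$, $(L:_{R_e}X)=\{r\in R_e: rX\subseteq L\}$. A submodule $L$ of the $R_e$-module $M_g$ is $g$-idempotent if $L=(L:_{R_e}M_g)^2M_g$; $M_g$ is fully $g$-idempotent if every $R_e$-submodule of $M_g$ is $g$-idempotent. For an ideal $A$ of $R_e$, $Gr(A)=\{x\in R_e: x^n\in A\text{ for some }n\geq 1\}$. An ideal $A$ of $R_e$ is $e$-$2$-absorbing primary if $A\neq R_e$ and whenever $r,s,t\in R_e$ with $rst\in A$, then $rs\in A$ or $rt\in Gr(A)$ or $st\in Gr(A)$.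 $N_g$ is a $g$-$G2$-absorbing submodule of the $R_e$-module $M_g$ if $N_g\neq M_g$ and whenever $r,s\in R_e$, $m\in M_g$ with $rsm\in N_g$, then $r^{k_1}\in(N_g:_{R_e}m)$ for some $k_1\in\mathbb{Z}^+$, or $s^{k_2}\in(N_g:_{R_e}m)$ for some $k_2\in\mathbb{Z}^+$, or $rs\in(N_g:_{R_e}M_g)$. *)

(* Defs.v *)
From mathcomp Require Import all_boot all_algebra.
From mathcomp Require Import boolp classical_sets.

Set Implicit Arguments.
Unset Strict Implicit.
Unset Printing Implicit Defensive.

Import GRing.Theory.

Local Open Scope classical_set_scope.
Local Open Scope ring_scope.

(* Homogeneous components are sets [set R] and [set M] rather than types.  The
   [R_e]-module [M_g] is accordingly the pair formed by the set of scalars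
   [Rg 1%g] and the set [Mg g], with the operations of [R] and [M].  Ideals are
   submodules of the regular module [R^o]. *)

Section Modules.
Variables (R : comPzRingType) (V : lmodType R).
Implicit Types (S A : set R) (W L X : set V).

Definition submodule_of S W L : Prop :=
  [/\ L `<=` W, zmod_closed (mem L) &
      forall r x, S r -> L x -> L (r *: x)].

Definition colon S L X : set R := [set r | S r /\ forall x, X x -> L (r *: x)].

Definition setprod A W : set V :=
  [set x | exists n (a : 'I_n -> R) (w : 'I_n -> V),
      (forall i, A (a i) /\ W (w i)) /\ x = \sum_(i < n) a i *: w i].

End Modules.

Section Ideals.
Variable R : comPzRingType.
Implicit Types S A B : set R.

Definition ideal_of S A : Prop := @submodule_of R R^o S S A.

Definition ideal_mul A B : set R := @setprod R R^o A B.

Definition radical S A : set R :=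
  [set x | S x /\ exists n, (1 <= n)%N /\ A (x ^+ n)].

Definition two_absorbing_primary S A : Prop :=
  [/\ ideal_of S A, A <> S &
      forall r s t, S r -> S s -> S t -> A (r * s * t) ->
        [\/ A (r * s), radical S A (r * t) | radical S A (s * t)]].

End Ideals.

Section Submodules.
Variables (R : comPzRingType) (V : lmodType R).
Implicit Types (S : set R) (W L : set V).

(* [L = (L :_S W)^2 W]. *)
Definition idempotent_sub S W L : Prop :=
  L = setprod (ideal_mul (colon S L W) (colon S L W)) W.

Definition fully_idempotent S W : Prop :=
  forall L, submodule_of S W L -> idempotent_sub S W L.

Definition G2_absorbing S W L : Prop :=
  [/\ submodule_of S W L, L <> W &
      forall r s m, S r -> S s -> W m -> L ((r * s) *: m) ->
        [\/ exists k, (1 <= k)%N /\ colon S L [set m] (r ^+ k),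
            exists k, (1 <= k)%N /\ colon S L [set m] (s ^+ k) |
            colon S L W (r * s)]].

End Submodules.

(* [W] is the internal direct sum of the family [F] of additive subgroups: every
   element of [W] is a finite sum of elements of the [F h], and finite families
   of elements taken from distinct [F h] are independent. *)
Definition direct_sum (G : groupType) (V : zmodType) (W : set V)
    (F : G -> set V) : Prop :=
  [/\ forall h, zmod_closed (mem (F h)),
      W = [set x | exists (s : seq G) (f : G -> V),
             [/\ uniq s, forall h, F h (f h) & x = \sum_(h <- s) f h]] &
      forall (s : seq G) (f : G -> V), uniq s -> (forall h, F h (f h)) ->
        \sum_(h <- s) f h = 0 -> forall h, h \in s -> f h = 0].

Section Graded.
Variables (G : groupType) (R : comPzRingType).
Implicit Type Rg : G -> set R.

Definition graded_ring Rg : Prop :=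
  direct_sum setT Rg /\
  forall g h r s, Rg g r -> Rg h s -> Rg (g * h)%g (r * s).

Definition graded_module Rg (M : lmodType R) (Mg : G -> set M) : Prop :=
  direct_sum setT Mg /\
  forall g h r m, Rg g r -> Mg h m -> Mg (g * h)%g (r *: m).

Definition graded_submodule (M : lmodType R) (Mg : G -> set M) (N : set M) :
    Prop :=
  submodule_of setT setT N /\ direct_sum N (fun h => N `&` Mg h).

Definition graded_ideal Rg (I : set R) : Prop := @graded_submodule R^o Rg I.

Definition gr_noetherian Rg : Prop :=
  forall I : nat -> set R, (forall n, graded_ideal Rg (I n)) ->
    (forall n, I n `<=` I n.+1) ->
    exists n0, forall n, (n0 <= n)%N -> I n = I n0.

End Graded.

(* Main.v *)
Require Import Defs.
From mathcomp Require Import all_boot all_algebra.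
From mathcomp Require Import boolp classical_sets.

(** Write [S] for [R_e], [W] for [M_g], [L] for [N_g], and let [m] be an
    element of [W] with [r s m] in [L].  Idempotency of the cyclic submodule
    [S m] says [S m = J^2 W] with [J = (S m : W)]; since [J W] lies in [S m],
    this gives [m = j m] for a single [j] in [J].  As [j W] lies in [S m], the
    product [r s j] lies in [(L : W)], so [r s] lies in [(L : W)] or one of
    [r j], [s j] has a power there.  In the second case
    [r^n m = r^n j^n m] lies in [L], and similarly for [s]. *)

Import GRing.Theory.

Local Open Scope classical_set_scope.
Local Open Scope ring_scope.

Section AdditiveSubgroups.
Variables (V : zmodType) (L : set V).
Hypothesis L_closed : zmod_closed (mem L).

Lemma zmod_closed_set0 : L 0.
Proof. by case: L_closed => + _; rewrite inE. Qed.

Lemma zmod_closed_setB x y : L x -> L y -> L (x - y).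
Proof.
case: L_closed => _ LB Lx Ly.
by move: (LB x y); rewrite !inE; apply.
Qed.

Lemma zmod_closed_setN x : L x -> L (- x).
Proof. by rewrite -sub0r; apply: zmod_closed_setB; apply: zmod_closed_set0. Qed.

Lemma zmod_closed_setD x y : L x -> L y -> L (x + y).
Proof.
move=> Lx Ly; rewrite -[y]opprK.
by apply: zmod_closed_setB => //; apply: zmod_closed_setN.
Qed.

Lemma zmod_closed_set_sum (I : Type) (s : seq I) (f : I -> V) :
  (forall i, L (f i)) -> L (\sum_(i <- s) f i).
Proof.
move=> Lf; apply: big_ind => //; first exact: zmod_closed_set0.
exact: zmod_closed_setD.
Qed.

End AdditiveSubgroups.

Lemma set_zmod_closed (V : zmodType) (L : set V) :
  L 0 -> (forall x y, L x -> L y -> L (x - y)) -> zmod_closed (mem L).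
Proof.
move=> L0 LB; split; first by rewrite inE.
by move=> x y; rewrite !inE; apply: LB.
Qed.

Section Fixing.
Variables (R : comPzRingType) (V : lmodType R).
Variables (S : set R) (W : set V).
Hypothesis S_closed : zmod_closed (mem S).
Hypothesis S1 : S 1.
Hypothesis SM : forall a b, S a -> S b -> S (a * b).
Hypothesis W_closed : zmod_closed (mem W).
Hypothesis WZ : forall a x, S a -> W x -> W (a *: x).

Definition cyclic_sub (m : V) : set V := [set x | exists2 a, S a & x = a *: m].

Lemma cyclic_sub_submodule m : W m -> submodule_of S W (cyclic_sub m).
Proof.
move=> Wm; split.
- by move=> _ [a Sa ->]; apply: WZ.
- apply: set_zmod_closed.
    by exists 0; [exact: zmod_closed_set0 | rewrite scale0r].
  move=> _ _ [a Sa ->] [b Sb ->]; exists (a - b); last by rewrite scalerBl.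
  exact: zmod_closed_setB.
- move=> b _ Sb [a Sa ->]; exists (b * a); last by rewrite scalerA.
  exact: SM.
Qed.

Definition cyclic_colon m : set R := colon S (cyclic_sub m) W.

Lemma cyclic_colon_fixing m : W m -> fully_idempotent S W ->
  exists2 j, cyclic_colon m j & j *: m = m.
Proof.
move=> Wm idem; have subm := cyclic_sub_submodule m Wm.
have Sm_closed : zmod_closed (mem (cyclic_sub m)) by case: subm.
have SmZ a x : S a -> cyclic_sub m x -> cyclic_sub m (a *: x).
  by case: subm => _ _; apply.
have J0 : cyclic_colon m 0.
  split; first exact: zmod_closed_set0.
  by move=> x _; rewrite scale0r; apply: zmod_closed_set0.
have JD a b : cyclic_colon m a -> cyclic_colon m b -> cyclic_colon m (a + b).
  move=> [Sa Ja] [Sb Jb]; split; first exact: zmod_closed_setD.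
  move=> x Wx; rewrite scalerDl.
  by apply: zmod_closed_setD => //; [apply: Ja | apply: Jb].
have JM a b : S b -> cyclic_colon m a -> cyclic_colon m (a * b).
  move=> Sb [Sa Ja]; split; first exact: SM.
  by move=> x Wx; rewrite mulrC -scalerA; apply: SmZ => //; apply: Ja.
(* With [J] for [cyclic_colon m], the set [J m] is closed under sums. To place [m] in it, it is
   enough to place there each term [b c w] of the expansion of [m] in [J^2 W]. *)
pose P x := exists2 j, cyclic_colon m j & x = j *: m.
have P0 : P 0 by exists 0 => //; rewrite scale0r.
have PD x y : P x -> P y -> P (x + y).
  move=> [a Ja ->] [b Jb ->]; exists (a + b); last by rewrite scalerDl.
  exact: JD.
suff [j Jj mE] : P m by exists j.
have : cyclic_sub m m by exists 1; rewrite ?scale1r.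
rewrite {1}(idem _ subm) => -[n [a [w [aw ->]]]].
apply: big_ind => // i _; have [[k [b [c [bc ->]]]] Ww] := aw i.
rewrite scaler_suml; apply: big_ind => // l _.
(* Only the factor [c] is spent on moving [w] into [S m]: [c w = d m], so [b c w = (b d) m], and
   [b d] stays in [J] because [b] does. *)
have [Jb [_ Jc]] := bc l; rewrite -scalerA.
have [d Sd ->] := Jc _ Ww.
by exists (b l * d); [exact: JM | rewrite scalerA].
Qed.

Lemma fully_idempotent_G2_absorbing L : fully_idempotent S W ->
  submodule_of S W L -> two_absorbing_primary S (colon S L W) ->
  G2_absorbing S W L.
Proof.
move=> idem subL [_ colonNS colonP]; have [_ _ LZ] := subL.
have SX a n : S a -> S (a ^+ n).
  by move=> Sa; elim: n => [|n IHn]; rewrite ?expr0 // exprS; apply: SM.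
split=> //.
  move=> LW; apply: colonNS; apply/seteqP; split=> [a []//|a Sa].
  by split=> // x Wx; rewrite LW; apply: WZ.
move=> r s m Sr Ss Wm Lrsm.
have [j [Sj Jj] jm] := cyclic_colon_fixing m Wm idem.
have jXm n : j ^+ n *: m = m.
  by elim: n => [|n IHn]; rewrite ?scale1r // exprS -scalerA IHn.
(* Evaluating [(a j)^k] at [m] gives [a^k m], since [j^k] fixes [m]. *)
have power_colon a : S a -> radical S (colon S L W) (a * j) ->
    exists k, (1 <= k)%N /\ colon S L [set m] (a ^+ k).
  move=> Sa [_ [k [k_gt0 [_ ajk]]]]; exists k; split=> //; split; first exact: SX.
  by move=> _ ->; have := ajk m Wm; rewrite exprMn -scalerA jXm.
(* For [x] in [W], [j x = d m] with [d] in [S], hence [r s j x = d (r s m)] lies in [L]. *)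
have : colon S L W (r * s * j).
  split; first by do 2?[apply: SM => //].
  move=> x Wx; rewrite -scalerA; have [d Sd ->] := Jj x Wx.
  by rewrite scalerA mulrC -scalerA; apply: LZ.
case/(colonP _ _ _ Sr Ss Sj) => [?|?|?].
- by apply: Or33.
- by apply: Or31; apply: power_colon.
- by apply: Or32; apply: power_colon.
Qed.

End Fixing.

(** Moving [x] to the other side, into the term of degree [k], leaves a vanishing sum of homogeneous
    elements of distinct degrees, so independence kills that term. *)
Lemma direct_sum_component (G : groupType) (V : zmodType) (W : set V)
    (F : G -> set V) (s : seq G) (f : G -> V) (k : G) (x : V) :
  direct_sum W F -> uniq s -> (forall h, F h (f h)) -> F k x ->
  x = \sum_(h <- s) f h -> x = if k \in s then f k else 0.
Proof.
move=> [F_closed _ indep] s_uniq Ff Fx xE.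
case: ifPn => ks.
  pose f' h := if h == k then f k - x else f h.
  have Ff' h : F h (f' h).
    rewrite /f'; case: eqP => [->|_] //.
    exact: (zmod_closed_setB _ _ (F_closed k)).
  have f'0 : \sum_(h <- s) f' h = 0.
    rewrite (bigD1_seq k) //= /f' eqxx.
    under eq_bigr => h /negPf hk do rewrite hk.
    by rewrite addrAC -bigD1_seq // -xE subrr.
  by have /eqP := indep s f' s_uniq Ff' f'0 k ks; rewrite /f' eqxx subr_eq0 => /eqP.
(* Here [k] is a new degree: [- x] is prepended as its term, and [k :: s] still has no
   repetition. *)
pose f' h := if h == k then - x else f h.
have Ff' h : F h (f' h).
  rewrite /f'; case: eqP => [->|_] //.
  exact: (zmod_closed_setN _ _ (F_closed k)).
have f'0 : \sum_(h <- k :: s) f' h = 0.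
  rewrite big_cons /f' eqxx [X in _ + X](_ : _ = x) ?addNr // xE.
  apply: eq_big_seq => h hs; case: eqP => // hk.
  by rewrite -hk hs in ks.
have ks_uniq : uniq (k :: s) by rewrite /= ks.
have := indep _ f' ks_uniq Ff' f'0 k (mem_head k s).
by rewrite /f' eqxx => /eqP; rewrite oppr_eq0 => /eqP.
Qed.

(* The degree-[e] component of [1] acts as the identity on every homogeneous
   element, by comparing components in [x = 1 x], hence equals [1]. *)
Lemma graded_ring1 (G : groupType) (R : comPzRingType) (Rg : G -> set R) :
  graded_ring Rg -> Rg 1%g 1.
Proof.
move=> [dsum RgM]; have [Rg_closed RgT _] := dsum.
have : [set: R] 1 by [].
rewrite {1}RgT => -[s [f [s_uniq Rf oneE]]].
(* The component of [1] of degree [e], which is zero when [e] is not listed in [s]. *)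
pose c := if 1%g \in s then f 1%g else 0.
have Rc : Rg 1%g c.
  by rewrite /c; case: ifP => // _; apply: (zmod_closed_set0 _ _ (Rg_closed 1%g)).
have c_id k x : Rg k x -> x = c * x.
  (* In [x = 1 x], the term [f h * x] has degree [h k]. Reindexing by [u = h k] gives a homogeneous
     decomposition of [x] whose term of degree [k] comes from [h = e], namely [c * x]. *)
  move=> Rx; pose f' u := f (u * k^-1)%g * x.
  have Rf' u : Rg u (f' u).
    by rewrite -[X in Rg X](mulgVK k u); apply: RgM.
  have mul_inj : injective (fun h => h * k)%g by apply: mulIg.
  have s'_uniq : uniq [seq (h * k)%g | h <- s] by rewrite map_inj_uniq.
  have xE : x = \sum_(u <- [seq (h * k)%g | h <- s]) f' u.
    rewrite big_map -{1}[x]mul1r oneE mulr_suml.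
    by apply: eq_bigr => h _; rewrite /f' mulgK.
  have ks' : (k \in [seq (h * k)%g | h <- s]) = (1%g \in s).
    by rewrite -[RHS](mem_map mul_inj) /= mul1g.
  rewrite {1}(direct_sum_component _ _ _ _ _ _ k x dsum s'_uniq Rf' Rx xE).
  rewrite ks' /c /f' mulgV.
  by case: ifP; rewrite ?mul0r.
suff -> : 1 = c by [].
(* As [c] fixes every homogeneous component of [1], it fixes their sum, so [c * 1 = 1]. *)
rewrite -[RHS]mulr1 oneE mulr_sumr; apply: eq_bigr => h _.
exact: c_id (Rf h).
Qed.

Theorem theorem3p2 (G : groupType) (G_abelian : forall x y : G, (x * y = y * x)%g)
    (R : comPzRingType) (Rg : G -> set R) (R_graded : graded_ring Rg)
    (R_noetherian : gr_noetherian Rg)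
    (M : lmodType R) (Mg : G -> set M) (M_graded : graded_module Rg Mg)
    (N : set M) (N_graded : graded_submodule Mg N) (g : G)
    (Mg_idempotent : fully_idempotent (Rg 1%g) (Mg g))
    (colon_primary :
      two_absorbing_primary (Rg 1%g) (colon (Rg 1%g) (N `&` Mg g) (Mg g))) :
  G2_absorbing (Rg 1%g) (Mg g) (N `&` Mg g).
Proof.
have Re1 := graded_ring1 _ _ _ R_graded.
case: R_graded => -[Rg_closed _ _] RgM.
case: M_graded => -[Mg_closed _ _] MgZ.
case: N_graded => -[_ _ NZ] [NMg_closed _ _].
have ReZ a x : Rg 1%g a -> Mg g x -> Mg g (a *: x).
  by move=> Ra Mx; rewrite -[g]mul1g; apply: MgZ.
(* Two conditions remain: [R_e] is closed under products, as [e e = e], and the component of [N] is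
   an [R_e]-submodule of [M_g], as [e g = g]. *)
apply: fully_idempotent_G2_absorbing => //.
- by move=> a b Ra Rb; rewrite -[1%g]mul1g; apply: RgM.
- split; [by move=> x [] | exact: NMg_closed |].
  by move=> a x Ra [Nx Mx]; split; [apply: NZ | apply: ReZ].
Qed.
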